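(* Let $m\ge1$, $0<R<+\infty$, and let $f$ be a holomorphic function in the closed polydisc $\overline{\mathbb{D}(0;R)}\subset\mathbb{C}^m$. Then $$M(r,f)\le\frac{2r}{R-r}A(R,f)+\frac{R+r}{R-r}|f(0)|$$ holds for all $r$ with $0\le\sqrt{m}\,r<R$.
   Context: $\overline{\mathbb{D}(0;R)}=\{z\in\mathbb{C}^m:|z_i|\le R,\ i=1,\ldots,m\}$ is the closed polydisc and $\mathbb{D}\langle 0;R\rangle=\{z\in\mathbb{C}^m:|z_i|=R,\ i=1,\ldots,m\}$ is its Shilov boundary. ''Holomorphic in'' the closed polydisc means holomorphic on an open neighbourhood of it. Define $A(R,f)=\max_{z\in\mathbb{D}\langle0;R\rangle}\Re\{f(z)\}$ and $M(r,f)=\max_{\|z\|=r}|f(z)|$, where $\|\cdot\|$ is the Euclidean norm on $\mathbb{C}^m$. *)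

(* Defs.v *)
From HB Require Import structures.
From mathcomp Require Import all_boot all_order all_algebra.
From mathcomp Require Import complex.
From mathcomp Require Import all_classical all_reals all_analysis.

Set Implicit Arguments.
Unset Strict Implicit.
Unset Printing Implicit Defensive.

Import Order.TTheory GRing.Theory Num.Theory.
Import numFieldNormedType.Exports.

Local Open Scope classical_set_scope.
Local Open Scope ring_scope.
Local Open Scope complex_scope.

(* [K[i]^o] is [K[i]] with its normed module structure over itself, so that
   [differentiable] below means complex (Frechet) differentiable. *)
Notation Cn K m := ('rV[K[i]^o]_m).

Definition modulus (K : realType) (z : K[i]) : K := complex.Re `|z|.

(* The norm of the normed module [Cn K m] is the sup norm. *)
Definition euclid_norm (K : realType) (m : nat) (z : Cn K m) : K :=
  Num.sqrt (\sum_(i < m) modulus (z ord0 i) ^+ 2).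

Definition closed_polydisc (K : realType) (m : nat) (R : K) : set (Cn K m) :=
  [set z | forall i : 'I_m, modulus (z ord0 i) <= R].

Definition shilov_boundary (K : realType) (m : nat) (R : K) : set (Cn K m) :=
  [set z | forall i : 'I_m, modulus (z ord0 i) = R].

Definition euclid_sphere (K : realType) (m : nat) (r : K) : set (Cn K m) :=
  [set z | euclid_norm z = r].

Arguments closed_polydisc {K} m R.
Arguments shilov_boundary {K} m R.
Arguments euclid_sphere {K} m r.

Definition holomorphic_on (K : realType) (m : nat) (U : set (Cn K m))
    (f : Cn K m -> K[i]^o) : Prop :=
  open U /\ forall z, U z -> differentiable f z.

(* Values of [f] outside of the neighbourhood [U] are irrelevant. *)
Definition holomorphic_near (K : realType) (m : nat) (E : set (Cn K m))
    (f : Cn K m -> K[i]^o) : Prop :=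
  exists U : set (Cn K m), E `<=` U /\ holomorphic_on U f.

(* The greatest element of [S]; a default value if [S] has none. *)
Definition maximum (K : realType) (S : set K) : K :=
  [get x | S x /\ ubound S x].

Lemma maximumE (K : realType) (S : set K) (x : K) :
  S x -> ubound S x -> maximum S = x.
Proof.
move=> Sx Ux; rewrite /maximum.
have [Sy Uy] : [set y | S y /\ ubound S y] (maximum S).
  by apply: (@getI _ _ x); split.
by apply/eqP; rewrite eq_le (Ux _ Sy) (Uy _ Sx).
Qed.

Definition max_Re (K : realType) (m : nat) (R : K) (f : Cn K m -> K[i]^o) : K :=
  maximum [set complex.Re (f z) | z in shilov_boundary m R].

Definition max_modulus (K : realType) (m : nat) (r : K)
    (f : Cn K m -> K[i]^o) : K :=
  maximum [set modulus (f z) | z in euclid_sphere m r].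

(* Main.v *)
Require Import Defs.
From mathcomp Require Import all_boot all_order all_algebra.
From mathcomp Require Import ring lra.
From mathcomp Require Import complex.
From mathcomp Require Import all_classical all_reals all_analysis.
Import Order.TTheory GRing.Theory Num.Theory.
Import numFieldNormedType.Exports.
Local Open Scope classical_set_scope.
Local Open Scope ring_scope.

Set Implicit Arguments.
Unset Strict Implicit.
Unset Printing Implicit Defensive.

(** A point [z] of the Euclidean sphere of radius [r] has all its coordinates in
    the disc of radius [r], so the complex line through [0] and [z] meets the
    closed polydisc of radius [R] in at least the disc [|t| <= R] of the function
    [g t := f (t z / r)].  The inequality is then the Borel-Caratheodory theorem
    for [g] at [t = r], once the real part of [g] is known to be at most
    [A(R, f)], the maximum of [Re f] over the Shilov boundary.  Both ingredients
    are maximum principles: Borel-Caratheodory follows from Schwarz's lemma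
    applied to [(g - g 0) / (2 A - (g - g 0))], and the bound on [Re f] from its
    being harmonic in each coordinate.

    Differentiability at every point, without continuity of the derivative, is
    all that is assumed, so the starting point has to be an argument of Goursat
    type.  It is carried out directly for the mean value property
    [mean_value_circle].  In logarithmic polar coordinates, where [t] is
    [exp (x + i y)], the real and imaginary parts [P] and [Q] of a holomorphic
    function satisfy [P_x = Q_y]; hence the flux of [(P, - Q)] out of any
    rectangle vanishes, by bisection ([goursat_rectangle]).  On a rectangle of
    height [2 pi] the contributions of [Q] cancel by periodicity, which says that
    the mean of [P] over a circle does not depend on its radius; when the radius
    tends to [0] the mean tends to the value at the centre.  As [exp] omits [0],
    continuity at the centre suffices there, and this is what makes the quotient
    [G t / t] of Schwarz's lemma accessible without a theorem on removable
    singularities.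

    The mean value property yields the maximum principle without any discussion
    of the equality case: adding a small multiple of the squared distance to the
    origin makes the mean over a circle strictly larger than the value at the
    centre, so that the perturbed function has no maximum at an interior point
    ([maximum_principle]).  In the polydisc a point lies off the Shilov boundary
    when one coordinate [z_i] has modulus less than [R], and then a circle in the
    direction of that coordinate is available ([Re_le_shilov]). *)

(** * Integrals of continuous functions over segments *)

Lemma integrable_segment (K : realType) (a b : K) (f : K -> K) :
  {within `[a, b], continuous f} ->
  (@lebesgue_measure K).-integrable `[a, b] (EFin \o f).
Proof.
move=> cf; apply: continuous_compact_integrable => //.
exact: segment_compact.
Qed.

Lemma integral_segment_le (K : realType) (a b k : K) (f : K -> K) :
  a <= b -> {within `[a, b], continuous f} ->
  (forall x, a <= x <= b -> f x <= k) ->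
  \int[@lebesgue_measure K]_(x in `[a, b]) f x <= k * (b - a).
Proof.
move=> ab cf fk.
have -> : k * (b - a) = \int[@lebesgue_measure K]_(x in `[a, b]) k.
  rewrite Rintegral_cst //= lebesgue_measure_itv /= lte_fin.
  by case: (ltgtP a b) ab => // -> _; rewrite subrr mulr0.
apply: le_Rintegral => //; first exact: integrable_segment.
by apply: (integrable_segment (f := cst k)) => x; exact: cvg_cst.
Qed.

Lemma integral_segment_near (K : realType) (a b k M : K) (f : K -> K) :
  a <= b -> {within `[a, b], continuous f} ->
  (forall x, a <= x <= b -> `|f x - k| <= M) ->
  `|\int[@lebesgue_measure K]_(x in `[a, b]) f x - k * (b - a)| <= M * (b - a).
Proof.
move=> ab cf fk.
have icf := integrable_segment cf.
have hi : \int[@lebesgue_measure K]_(x in `[a, b]) f x <= (k + M) * (b - a).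
  apply: integral_segment_le => // x /fk.
  by rewrite ler_norml lerBlDl => /andP[].
have lo : \int[@lebesgue_measure K]_(x in `[a, b]) (-1 * f x) <=
    (M - k) * (b - a).
  apply: integral_segment_le => //; first by move=> x; apply: cvgMr; exact: cf.
  move=> x /fk; rewrite ler_norml mulN1r lerBrDl => /andP[? _].
  by rewrite lerNl opprB.
move: hi lo; rewrite RintegralZl //; move: (Rintegral _ _ _) => I.
by clear => hi lo; rewrite ler_norml; apply/andP; split; lra.
Qed.

Lemma integral_segment_split (K : realType) (a b c : K) (f : K -> K) :
  a <= c -> c <= b -> {within `[a, b], continuous f} ->
  \int[@lebesgue_measure K]_(x in `[a, b]) f x =
  \int[@lebesgue_measure K]_(x in `[a, c]) f x +
  \int[@lebesgue_measure K]_(x in `[c, b]) f x.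
Proof.
move=> ac cb /integrable_segment icf.
rewrite -[X in _ = _ + X]Rintegral_itv_obnd_cbnd.
  by rewrite -(Rintegral_itvB (x := c) icf) ?bnd_simp // addrC subrK.
by apply: integrableS icf => //; apply: subset_itvr; rewrite bnd_simp.
Qed.

(** * Goursat's lemma for a divergence-free field on a rectangle *)

(** The field [(P, - Q)] is differentiable at [(x, y)], with divergence [0]
    there: one and the same number [a] is both [P_x] and [Q_y]. *)
Definition divergence_free_at (K : realType) (P Q : K -> K -> K) (x y : K) :=
  exists a b c : K, forall e, 0 < e -> exists2 d, 0 < d & forall h k,
    `|h| <= d -> `|k| <= d ->
    `|P (x + h) (y + k) - P x y - (a * h + b * k)| <= e * (`|h| + `|k|) /\
    `|Q (x + h) (y + k) - Q x y - (c * h + a * k)| <= e * (`|h| + `|k|).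

Lemma continuous_lipschitz_at (K : realType) (f : K -> K) (x C d : K) :
  0 < d -> (forall h, `|h| <= d -> `|f (x + h) - f x| <= C * `|h|) ->
  {for x, continuous f}.
Proof.
move=> d0 fC; apply/cvgrPdist_le => /= e e0.
have C0 : 0 < `|C| + 1 by rewrite ltr_wpDl.
have e'0 : 0 < Num.min d (e / (`|C| + 1)) by rewrite lt_min d0 divr_gt0.
near=> t; have : `|t - x| <= Num.min d (e / (`|C| + 1)).
  by near: t; apply: (@cvgr_distC_le _ _ _ (nbhs x) _ id x).
rewrite le_min => /andP[/fC]; rewrite subrKC distrC ler_pdivlMr // => fx te.
apply: le_trans fx _; apply: le_trans te.
rewrite mulrC ler_wpM2l //; apply: le_trans (ler_norm _) _.
by rewrite lerDl.
Unshelve. all: by end_near. Qed.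

Lemma divergence_free_continuous (K : realType) (P Q : K -> K -> K) (x y : K) :
  divergence_free_at P Q x y ->
  {for y, continuous (P x)} /\ {for x, continuous (Q ^~ y)}.
Proof.
move=> [a [b [c /(_ 1 ltr01) [d d0 PQ]]]].
have d00 : `|0 : K| <= d by rewrite normr0 ltW.
split.
  apply: (@continuous_lipschitz_at _ _ _ (1 + `|b|) d) => // k kd.
  have [+ _] := PQ 0 k d00 kd.
  rewrite addr0 mulr0 add0r normr0 add0r mul1r => h.
  rewrite -[_ - _](subrK (b * k)); apply: le_trans (ler_normD _ _) _.
  by rewrite mulrDl mul1r normrM lerD.
apply: (@continuous_lipschitz_at _ _ _ (1 + `|c|) d) => // h hd.
have [_] := PQ h 0 hd d00.
rewrite addr0 mulr0 addr0 normr0 addr0 mul1r => H.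
rewrite -[_ - _](subrK (c * h)); apply: le_trans (ler_normD _ _) _.
by rewrite mulrDl mul1r normrM lerD.
Qed.

Lemma ler_dist_segment (K : realType) (a b u x : K) :
  a <= u -> u <= b -> a <= x -> x <= b -> `|u - x| <= b - a.
Proof. by rewrite ler_norml => *; apply/andP; split; lra. Qed.

Lemma ler_dist_increment (K : realType) (a b x l m e s p q r : K) :
  `|q - r - (l * (b - x) + m)| <= e / 2 * s ->
  `|p - r - (l * (a - x) + m)| <= e / 2 * s ->
  `|q - p - l * (b - a)| <= e * s.
Proof.
by rewrite !ler_norml => /andP[? ?] /andP[? ?]; apply/andP; split; lra.
Qed.

Lemma ler_dist_flux (K : realType) (V H l e x y : K) :
  `|V - l * x * y| <= e * (x + y) * y -> `|H - l * y * x| <= e * (x + y) * x ->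
  `|V - H| <= e * (x + y) ^+ 2.
Proof.
rewrite !ler_norml => /andP[? ?] /andP[? ?].
have -> : e * (x + y) ^+ 2 = e * (x + y) * y + e * (x + y) * x by ring.
by apply/andP; split; lra.
Qed.

(** The selection step of the bisection: of four fluxes, one has at least a
    quarter of the size of their sum. *)
Lemma le_norm4 (K : realType) (e a b c d : K) :
  e *+ 4 <= `|a + b + (c + d)| ->
  [\/ e <= `|a|, e <= `|b|, e <= `|c| | e <= `|d|].
Proof.
move=> le4; have [] := leP e `|a|; first by move=> *; apply: Or41.
have [] := leP e `|b|; first by move=> *; apply: Or42.
have [] := leP e `|c|; first by move=> *; apply: Or43.
have [] := leP e `|d|; first by move=> *; apply: Or44.
move=> ld lc lb la; have := le_lt_trans le4 (le_lt_trans (ler_normD _ _)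
  (le_lt_trans (lerD (ler_normD _ _) (ler_normD _ _))
    (ltrD (ltrD la lb) (ltrD lc ld)))).
by rewrite -mulr_natr; lra.
Qed.

(** Suprema replace limits here: a point common to all the segments is all that
    the bisection needs. *)
Lemma nested_segments (K : realType) (u v : nat -> K) :
  (forall n, u n <= u n.+1) -> (forall n, v n.+1 <= v n) ->
  (forall n, u n <= v n) -> exists x, forall n, u n <= x <= v n.
Proof.
move=> uS vS uv.
have un m n : (m <= n)%N -> u m <= u n.
  exact: (homo_leq (@lexx _ K) le_trans).
have vn m n : (m <= n)%N -> v n <= v m.
  apply: (homo_leq (@lexx _ K) (r := fun x y => y <= x)) => //.
  by move=> a b c ba cb; exact: le_trans cb ba.
have ub m : ubound (range u) (v m).
  move=> _ [n _ <-]; have [mn|/ltnW nm] := leqP m n.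
    exact: le_trans (uv n) (vn _ _ mn).
  exact: le_trans (un _ _ nm) (uv m).
exists (sup (range u)) => n; apply/andP; split.
  by apply: ub_le_sup; [exists (v 0%N); exact: ub|exists n].
by apply: ge_sup; [exists (u 0%N), 0%N|exact: ub].
Qed.

(** The flux of the field [(P, - Q)] out of the rectangle [[a, b] x [c, d]]. *)
Definition flux (K : realType) (P Q : K -> K -> K) (a b c d : K) : K :=
  \int[@lebesgue_measure K]_(y in `[c, d]) (P b y - P a y) -
  \int[@lebesgue_measure K]_(x in `[a, b]) (Q x d - Q x c).

Section goursat.
Context (K : realType) (P Q : K -> K -> K) (a0 b0 c0 d0 : K).
Context (dfPQ : forall x y, a0 <= x <= b0 -> c0 <= y <= d0 ->
  divergence_free_at P Q x y).

Let within_vert a b c d : a0 <= a -> a <= b -> b <= b0 -> c0 <= c -> d <= d0 ->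
  {within `[c, d], continuous (fun y => P b y - P a y)}.
Proof.
move=> aa ab bb cc dd; apply: continuous_in_subspaceT => y.
rewrite inE /= in_itv /= => /andP[cy yd].
have y0 : c0 <= y <= d0 by rewrite (le_trans cc cy) (le_trans yd dd).
apply: cvgB.
  have /dfPQ/(_ y0)/divergence_free_continuous[] // : a0 <= b <= b0.
  by rewrite bb (le_trans aa).
have /dfPQ/(_ y0)/divergence_free_continuous[] // : a0 <= a <= b0.
by rewrite aa (le_trans ab).
Qed.

Let within_horiz a b c d : a0 <= a -> b <= b0 -> c0 <= c -> c <= d -> d <= d0 ->
  {within `[a, b], continuous (fun x => Q x d - Q x c)}.
Proof.
move=> aa bb cc cd dd; apply: continuous_in_subspaceT => x.
rewrite inE /= in_itv /= => /andP[ax xb].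
have x0 : a0 <= x <= b0 by rewrite (le_trans aa ax) (le_trans xb bb).
apply: cvgB.
  have /(dfPQ x0)/divergence_free_continuous[] // : c0 <= d <= d0.
  by rewrite dd (le_trans cc).
have /(dfPQ x0)/divergence_free_continuous[] // : c0 <= c <= d0.
by rewrite cc (le_trans cd).
Qed.

Let flux_splitx a m b c d : a0 <= a -> a <= m -> m <= b -> b <= b0 ->
  c0 <= c -> c <= d -> d <= d0 ->
  flux P Q a b c d = flux P Q a m c d + flux P Q m b c d.
Proof.
move=> aa am mb bb cc cd dd; rewrite /flux.
rewrite (@integral_segment_split _ a b m) //; last exact: within_horiz.
have -> : \int[@lebesgue_measure K]_(y in `[c, d]) (P b y - P a y) =
    \int[@lebesgue_measure K]_(y in `[c, d]) ((P b y - P m y) + (P m y - P a y)).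
  by apply: eq_Rintegral => y _; rewrite subrKA.
rewrite RintegralD //.
- by rewrite [X in X - _]addrC opprD addrACA.
- apply: integrable_segment; apply: within_vert => //; exact: le_trans am.
- apply: integrable_segment; apply: within_vert => //; exact: le_trans mb bb.
Qed.

Let flux_splity a b c m d : a0 <= a -> a <= b -> b <= b0 ->
  c0 <= c -> c <= m -> m <= d -> d <= d0 ->
  flux P Q a b c d = flux P Q a b c m + flux P Q a b m d.
Proof.
move=> aa ab bb cc cm md dd; rewrite /flux.
rewrite (@integral_segment_split _ c d m) //; last exact: within_vert.
have -> : \int[@lebesgue_measure K]_(x in `[a, b]) (Q x d - Q x c) =
    \int[@lebesgue_measure K]_(x in `[a, b]) ((Q x d - Q x m) + (Q x m - Q x c)).
  by apply: eq_Rintegral => x _; rewrite subrKA.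
rewrite [X in _ - X]RintegralD //.
- by rewrite [X in _ - X]addrC opprD addrACA.
- apply: integrable_segment; apply: within_horiz => //; exact: le_trans cm.
- apply: integrable_segment; apply: within_horiz => //; exact: le_trans md dd.
Qed.

(** Near [(x, y)] the field is affine up to a small error.  The flux of the affine
    part cancels: its two terms are both [al (b - a) (c' - c)], where [al] is the
    common value of [P_x] and [Q_y].  The error is small compared to the square
    of the size of the rectangle. *)
Let flux_local (x y : K) : a0 <= x <= b0 -> c0 <= y <= d0 ->
  forall e, 0 < e -> exists2 d, 0 < d & forall a b c c',
    a0 <= a -> a <= x -> x <= b -> b <= b0 ->
    c0 <= c -> c <= y -> y <= c' -> c' <= d0 -> b - a <= d -> c' - c <= d ->
    `|flux P Q a b c c'| <= e * ((b - a) + (c' - c)) ^+ 2.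
Proof.
move=> hx hy e e0; have [al [be [ga]]] := dfPQ hx hy.
have e20 : 0 < e / 2 by rewrite divr_gt0.
move=> /(_ _ e20) [d dpos hd]; exists d => // a b c c' aa ax xb bb cc cy yc dd.
move=> bad ccd; set s := b - a + (c' - c).
have near u v : a <= u <= b -> c <= v <= c' ->
    `|P u v - P x y - (al * (u - x) + be * (v - y))| <= e / 2 * s /\
    `|Q u v - Q x y - (al * (v - y) + ga * (u - x))| <= e / 2 * s.
  move=> /andP[au ub] /andP[cv vc].
  have ux : `|u - x| <= b - a.
    exact: ler_dist_segment.
  have vy : `|v - y| <= c' - c.
    exact: ler_dist_segment.
  have [] := hd (u - x) (v - y) (le_trans ux bad) (le_trans vy ccd).
  rewrite !subrKC [ga * _ + _]addrC => h1 h2.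
  have us : e / 2 * (`|u - x| + `|v - y|) <= e / 2 * s.
    by rewrite ler_wpM2l ?(ltW e20) // lerD.
  by split; apply: le_trans us.
have ab := le_trans ax xb; have cc' := le_trans cy yc.
have hV : `|\int[@lebesgue_measure K]_(t in `[c, c']) (P b t - P a t) -
    al * (b - a) * (c' - c)| <= e * s * (c' - c).
  apply: integral_segment_near => //; first exact: within_vert.
  move=> t ht; have [hb _] := near b t ltac:(by rewrite lexx ab) ht.
  have [ha _] := near a t ltac:(by rewrite lexx ab) ht.
  exact: (ler_dist_increment hb ha).
have hH : `|\int[@lebesgue_measure K]_(t in `[a, b]) (Q t c' - Q t c) -
    al * (c' - c) * (b - a)| <= e * s * (b - a).
  apply: integral_segment_near => //; first exact: within_horiz.
  move=> t ht; have [_ hb] := near t c' ht ltac:(by rewrite lexx cc').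
  have [_ ha] := near t c ht ltac:(by rewrite lexx cc').
  exact: (ler_dist_increment hb ha).
rewrite /flux; move: hV hH; move: (Rintegral _ _ _) (Rintegral _ _ _) => V H.
move=> hV hH; exact: ler_dist_flux hV hH.
Qed.

(** Were the flux non-zero, repeated halving of both sides would produce nested
    rectangles, the [n]-th with flux at least [4 ^- n] times the first one, which
    contradicts [flux_local] at their common point. *)
Lemma goursat_rectangle : a0 <= b0 -> c0 <= d0 -> flux P Q a0 b0 c0 d0 = 0.
Proof.
move=> ab cd; apply/eqP/negPn/negP => flux0.
pose w := b0 - a0; pose h := d0 - c0; pose g n : K := 2^-1 ^+ n.
have w0 : 0 <= w by rewrite subr_ge0.
have h0 : 0 <= h by rewrite subr_ge0.
have g0 n : 0 < g n by rewrite exprn_gt0 // invr_gt0.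
have gS n : g n = g n.+1 + g n.+1.
  by rewrite /g exprS; field.
pose eta := `|flux P Q a0 b0 c0 d0|.
have eta0 : 0 < eta by rewrite normr_gt0.
pose fl n (p : K * K) := flux P Q p.1 (p.1 + w * g n) p.2 (p.2 + h * g n).
pose inv n (p : K * K) := [/\ a0 <= p.1, p.1 + w * g n <= b0, c0 <= p.2,
  p.2 + h * g n <= d0 & eta * g n ^+ 2 <= `|fl n p|].
pose sub n (p q : K * K) := [/\ p.1 <= q.1,
  q.1 + w * g n.+1 <= p.1 + w * g n, p.2 <= q.2 &
  q.2 + h * g n.+1 <= p.2 + h * g n].
have step n p : inv n p -> exists q, inv n.+1 q /\ sub n p q.
  case: p => a c [] /= aa bb cc dd; rewrite /fl /=.
  set b := a + w * g n; set d := c + h * g n.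
  set x := w * g n.+1; set y := h * g n.+1.
  have x0 : 0 <= x by rewrite mulr_ge0 // ltW.
  have y0 : 0 <= y by rewrite mulr_ge0 // ltW.
  have bE : b = a + x + x by rewrite /b gS mulrDr addrA.
  have dE : d = c + y + y by rewrite /d gS mulrDr addrA.
  have ax : a <= a + x by rewrite lerDl.
  have xb : a + x <= b by rewrite bE lerDl.
  have cy : c <= c + y by rewrite lerDl.
  have yd : c + y <= d by rewrite dE lerDl.
  rewrite (@flux_splitx a (a + x) b) //; last exact: le_trans yd.
  rewrite (@flux_splity a (a + x) c (c + y) d) //; last exact: le_trans bb.
  rewrite (@flux_splity (a + x) b c (c + y) d) //; last exact: le_trans ax.
  move=> big.
  have sel (f1 f2 f3 f4 : K) : eta * g n ^+ 2 <= `|f1 + f2 + (f3 + f4)| ->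
     [\/ eta * g n.+1 ^+ 2 <= `|f1|, eta * g n.+1 ^+ 2 <= `|f2|,
         eta * g n.+1 ^+ 2 <= `|f3| | eta * g n.+1 ^+ 2 <= `|f4|].
    rewrite gS; have -> : eta * (g n.+1 + g n.+1) ^+ 2 =
      eta * g n.+1 ^+ 2 *+ 4 by rewrite -mulr_natr; ring.
    exact: le_norm4.
  have [] := sel _ _ _ _ big; rewrite /inv /sub /fl /=.
  - exists (a, c) => /=; rewrite -/x -/y; split; split => //.
    + exact: le_trans xb bb.
    + exact: le_trans yd dd.
  - exists (a, c + y) => /=; rewrite -/x -/y -?dE; split; split => //.
    + exact: le_trans xb bb.
    + exact: le_trans cy.
  - exists (a + x, c) => /=; rewrite -/x -/y -?bE; split; split => //.
    + exact: le_trans ax.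
    + exact: le_trans yd dd.
  - exists (a + x, c + y) => /=; rewrite -/x -/y -?bE -?dE; split; split => //.
    + exact: le_trans ax.
    + exact: le_trans cy.
pose next n p := xget p [set q | inv n.+1 q /\ sub n p q].
pose s := fix s n := if n is n'.+1 then next n' (s n') else (a0, c0).
have inv_s n : inv n (s n).
  elim: n => [|n ih]; last first.
    rewrite /= /next; case: xgetP => [q _ [] //|none].
    by have [q hq] := step _ _ ih; case: (none q hq).
  by rewrite /inv /fl /= /g expr0 !mulr1 /w /h !subrKC expr1n mulr1.
have sub_s n : sub n (s n) (s n.+1).
  rewrite /= /next; case: xgetP => [q _ [] //|none].
  by have [q hq] := step _ _ (inv_s n); case: (none q hq).
have [x hx] : exists x, forall n, (s n).1 <= x <= (s n).1 + w * g n.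
  apply: nested_segments => n; try by case: (sub_s n).
  by rewrite lerDl mulr_ge0 // ltW.
have [y hy] : exists y, forall n, (s n).2 <= y <= (s n).2 + h * g n.
  apply: nested_segments => n; try by case: (sub_s n).
  by rewrite lerDl mulr_ge0 // ltW.
have x0 : a0 <= x <= b0.
  by have := hx 0%N; rewrite /= /g mulr1 subrKC.
have y0 : c0 <= y <= d0.
  by have := hy 0%N; rewrite /= /g mulr1 subrKC.
have wh0 : 0 < (w + h) ^+ 2 + 1 by rewrite ltr_wpDl // sqr_ge0.
have e0 : 0 < eta / ((w + h) ^+ 2 + 1) by rewrite divr_gt0.
have [d d0' small] := flux_local x0 y0 e0.
have [n ng] : exists n, (w + h) * g n <= d.
  have : (w + h) * g n @[n --> \oo] --> (0 : K).
    rewrite -[X in _ --> X](mulr0 (w + h)); apply: cvgMr.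
    by apply: cvg_expr; rewrite ger0_norm ?invf_lt1 ?ltr1n.
  move=> /cvgr0_norm_le /(_ _ d0') [n _ /(_ n (leqnn n)) hn].
  by exists n; apply: le_trans hn; exact: ler_norm.
have [aa bb cc dd] := inv_s n.
have /andP[ax xb] := hx n; have /andP[cy yd] := hy n.
apply/negP; rewrite -ltNge /fl.
have := small _ _ _ _ aa ax xb bb cc cy yd dd.
rewrite ![_ + _ - _]addrC !addKr => /(_ _ _) hs.
apply: le_lt_trans (hs _ _) _.
- by apply: le_trans ng; rewrite ler_pM2r // lerDl.
- by apply: le_trans ng; rewrite ler_pM2r // lerDr.
rewrite -mulrDl exprMn mulrA ltr_pM2r ?exprn_gt0 //.
by rewrite mulrAC ltr_pdivrMr // ltr_pM2l // ltrDl.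
Qed.

End goursat.

(** * Moduli, continuity and derivatives of complex functions *)

Local Open Scope complex_scope.

Lemma derivable_littleo (R : numFieldType) (f : R^o -> R^o) (a e : R) :
  derivable f a 1 -> 0 < e ->
  \forall h \near (0 : R^o), `|f (a + h) - f a - h * 'D_1 f a| <= e * `|h|.
Proof.
move=> /derivable_nbhs/eqaddoP/[apply]; apply: filterS => h /=.
by rewrite !fctE /= scaler1 [h + a]addrC opprD addrA.
Qed.

(** The order of [K[i]] is partial and its norm takes values in [K[i]]; the
    lemmas below restate norms, neighbourhoods and derivatives with the
    real-valued [modulus], so that estimates take place in [K]. *)
Section modulus_theory.
Context (K : realType).
Implicit Types z w : K[i].

Lemma modulusE z : `|z| = (modulus z)%:C. Proof. by []. Qed.
Lemma modulus_ge0 z : 0 <= modulus z.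
Proof. by case: z => x y; exact: sqrtr_ge0. Qed.
Lemma modulusM z w : modulus (z * w) = modulus z * modulus w.
Proof. exact: ComplexField.Normc.normcM. Qed.
Lemma modulusV z : modulus z^-1 = (modulus z)^-1.
Proof. exact: ComplexField.Normc.normcV. Qed.
Lemma ler_modulusD z w : modulus (z + w) <= modulus z + modulus w.
Proof. exact: le_normcD. Qed.
Lemma modulusN z : modulus (- z) = modulus z.
Proof. exact: normcN. Qed.
Lemma modulusB z w : modulus (z - w) = modulus (w - z).
Proof. by rewrite -modulusN opprB. Qed.
Lemma modulus0 : modulus (0 : K[i]) = 0.
Proof. exact: ComplexField.Normc.normc0. Qed.
Lemma modulus_eq0 z : (modulus z == 0) = (z == 0).
Proof. by rewrite -(normr_eq0 z) modulusE -(inj_eq (@complexI K)). Qed.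
Lemma modulus_gt0 z : (0 < modulus z) = (z != 0).
Proof. by rewrite lt0r modulus_ge0 modulus_eq0 andbT. Qed.
Lemma modulus_real (x : K) : modulus x%:C = `|x|.
Proof. by rewrite /modulus /= expr0n addr0 sqrtr_sqr. Qed.
Lemma modulus_sqr z : modulus z ^+ 2 = complex.Re z ^+ 2 + complex.Im z ^+ 2.
Proof. by case: z => x y; rewrite sqr_sqrtr // addr_ge0 // sqr_ge0. Qed.
Lemma ler_Re z : `|complex.Re z| <= modulus z.
Proof. by rewrite -lecR; exact: normc_ge_Re. Qed.
Lemma ler_Im z : `|complex.Im z| <= modulus z.
Proof.
by rewrite -(@ler_pXn2r _ 2) ?nnegrE ?modulus_ge0 // modulus_sqr
  real_normK ?num_real // lerDr sqr_ge0.
Qed.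
Lemma ler_modulus z : modulus z <= `|complex.Re z| + `|complex.Im z|.
Proof.
rewrite -(@ler_pXn2r _ 2) ?nnegrE ?modulus_ge0 ?addr_ge0 // modulus_sqr.
rewrite sqrrD !real_normK ?num_real // addrAC lerDl mulrn_wge0 //.
Qed.

Lemma ReB z w : complex.Re (z - w) = complex.Re z - complex.Re w.
Proof. by case: z; case: w. Qed.
Lemma ImB z w : complex.Im (z - w) = complex.Im z - complex.Im w.
Proof. by case: z; case: w. Qed.

Lemma gt0_complexP (e : K[i]) : 0 < e -> exists2 d : K, 0 < d & e = d%:C.
Proof.
case: e => a b; rewrite ltcE /= => /andP[/eqP -> a0].
by exists a.
Qed.

Lemma near_modulusP (a : K[i]) (P : K[i] -> Prop) :
  (\forall t \near (a : K[i]^o), P t) <->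
  exists2 d, 0 < d & forall t, modulus (t - a) <= d -> P t.
Proof.
split=> [/nbhs_ballP[e /= e0 he]|[d d0 hd]].
  have [d d0 ed] := gt0_complexP e0; exists (d / 2); first by rewrite divr_gt0.
  move=> t td; apply: he; rewrite -ball_normE /= distrC modulusE ed ltcR.
  by apply: le_lt_trans td _; rewrite ltr_pdivrMr // mulr_natr mulr2n ltrDl.
apply/nbhs_ballP; exists d%:C => /=; first by rewrite ltcR.
by move=> t; rewrite -ball_normE /= distrC modulusE ltcR => /ltW/hd.
Qed.

Lemma continuous_modulusP (F : K[i]^o -> K[i]^o) (a : K[i]^o) :
  {for a, continuous F} <-> forall e : K, 0 < e ->
    exists2 d, 0 < d & forall t, modulus (t - a) <= d -> modulus (F t - F a) <= e.
Proof.
split=> [/cvgrPdist_le Fa e e0|Fa].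
  have /Fa/near_modulusP[d d0 hd] : 0 < e%:C by rewrite ltcR.
  by exists d => // t /hd; rewrite distrC modulusE lecR.
apply/(cvgrPdist_le (F := nbhs a)) => e /gt0_complexP[r /Fa[d d0 hd] ->].
by apply/near_modulusP; exists d => // t /hd; rewrite distrC modulusE lecR.
Qed.

Lemma derivable_modulus (F : K[i]^o -> K[i]^o) (a : K[i]) :
  derivable F a 1 -> forall e : K, 0 < e -> exists2 d, 0 < d &
    forall t, modulus t <= d ->
      modulus (F (a + t) - F a - t * 'D_1 F a) <= e * modulus t.
Proof.
move=> Fa e e0; have : 0 < e%:C by rewrite ltcR.
move=> /(derivable_littleo Fa)/near_modulusP[d d0 hd]; exists d => // t.
rewrite -[X in modulus X <= d]subr0 => /hd.
by rewrite !modulusE -rmorphM lecR.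
Qed.

End modulus_theory.

(** * The complex exponential and the mean value property *)

Section exponential.
Context (K : realType).
Implicit Types x y h k : K.

Definition cexp x y : K[i] := (expR x * cos y) +i* (expR x * sin y).

Lemma cexpD x y h k : cexp (x + h) (y + k) = cexp x y * cexp h k.
Proof.
by apply/eqP; rewrite eq_complex /= expRD cosD sinD; apply/andP; split;
  apply/eqP; ring.
Qed.

Lemma modulus_cexp x y : modulus (cexp x y) = expR x.
Proof.
apply/eqP; rewrite -(@eqrXn2 _ 2) ?modulus_ge0 ?expR_ge0 // modulus_sqr /=.
by rewrite !exprMn -mulrDr cos2Dsin2 mulr1.
Qed.

Lemma cexp_periodic x : cexp x (pi *+ 2) = cexp x 0.
Proof. by rewrite /cexp cos2pi sin2pi cos0 sin0. Qed.

Lemma near0_distP (P : K -> Prop) : (\forall h \near (0 : K^o), P h) ->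
  exists2 d, 0 < d & forall h, `|h| <= d -> P h.
Proof.
move=> /nbhs_ballP[e /= e0 he]; exists (e / 2); first by rewrite divr_gt0.
move=> h hd; apply: he; rewrite -ball_normE /= sub0r normrN.
by apply: le_lt_trans hd _; rewrite ltr_pdivrMr // mulr_natr mulr2n ltrDl.
Qed.

(** The exponential is differentiable at the origin with derivative [1]; by
    [cexpD] this controls it near any other point. *)
Lemma cexp_near0 (e : K) : 0 < e -> exists2 d, 0 < d & forall h k,
  `|h| <= d -> `|k| <= d ->
  modulus (cexp h k - 1 - (h +i* k)) <= e * (`|h| + `|k|).
Proof.
move=> e0; have [e' [e'0 e'1 e'e]] : exists e', [/\ 0 < e', e' <= 1 & e' * 8 <= e].
  exists (Num.min 1 (e / 8)); split; first by rewrite lt_min ltr01 divr_gt0.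
    by rewrite ge_min lexx.
  by rewrite -ler_pdivlMr // ge_min lexx orbT.
(* The final estimate adds up to [8 * e'] times the size of [(h, k)]. *)
have [d1 d10 hexp] := near0_distP (derivable_littleo
  (@ex_derive _ _ _ _ _ _ _ (is_derive_expR (0 : K))) e'0).
have [d2 d20 hcos] := near0_distP (derivable_littleo
  (@ex_derive _ _ _ _ _ _ _ (is_derive_cos (0 : K))) e'0).
have [d3 d30 hsin] := near0_distP (derivable_littleo
  (@ex_derive _ _ _ _ _ _ _ (is_derive_sin (0 : K))) e'0).
exists (Num.min e' (Num.min d1 (Num.min d2 d3))).
  by rewrite !lt_min e'0 d10 d20 d30.
move=> h k; rewrite !le_min => /and4P[he h1 _ _] /and4P[_ _ k2 k3].
have := hexp _ h1; have := hcos _ k2; have := hsin _ k3.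
rewrite !derive_val !add0r expR0 cos0 sin0 mulr1 oppr0 mulr0 !subr0 addr0 mulr1.
move=> sk ck eh; apply: le_trans (ler_modulus _) _ => /=.
rewrite !subr0.
have eh1 : `|expR h - 1| <= 2 * `|h|.
  rewrite -[_ - 1](subrK h); apply: le_trans (ler_normD _ _) _.
  rewrite mulr_natl mulr2n lerD2r; apply: le_trans eh _.
  by rewrite ler_piMl.
have eh3 : expR h <= 3.
  have := le_trans (ler_norm _) eh1; move: (le_trans he e'1).
  by clear => *; lra.
have -> : expR h * cos k - 1 - h = expR h * (cos k - 1) + (expR h - 1 - h).
  by ring.
have -> : expR h * sin k - k = expR h * (sin k - k) + (expR h - 1) * k.
  by ring.
have hck : `|expR h * (cos k - 1)| <= 3 * (e' * `|k|).
  by rewrite normrM ger0_norm ?expR_ge0 // ler_pM ?expR_ge0.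
have hsk : `|expR h * (sin k - k)| <= 3 * (e' * `|k|).
  by rewrite normrM ger0_norm ?expR_ge0 // ler_pM ?expR_ge0.
have hek : `|(expR h - 1) * k| <= 2 * e' * `|k|.
  rewrite normrM ler_wpM2r //; apply: le_trans eh1 _.
  by rewrite ler_wpM2l.
apply: le_trans (lerD (ler_normD _ _) (ler_normD _ _)) _.
apply: le_trans (lerD (lerD hck eh) (lerD hsk hek)) _.
apply: (@le_trans _ _ (e' * 8 * (`|h| + `|k|))); last first.
  by rewrite ler_wpM2r // addr_ge0.
have : 0 <= e' * `|h| by rewrite mulr_ge0 // ltW.
by clear => *; lra.
Qed.

(** The Cauchy-Riemann equations in logarithmic polar coordinates: the partial
    derivatives of [F (exp (x + i y))] in [x] and [y] are [kap] and [i kap], with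
    [kap := exp (x + i y) F' (exp (x + i y))], so that [P_x] and [Q_y] both equal
    the real part of [kap]. *)
Lemma divergence_free_cexp (F : K[i]^o -> K[i]^o) x y :
  derivable F (cexp x y) 1 ->
  divergence_free_at (fun x y => complex.Re (F (cexp x y)))
    (fun x y => complex.Im (F (cexp x y))) x y.
Proof.
move=> dF; set w := cexp x y; set kap := w * 'D_1 F w.
exists (complex.Re kap), (- complex.Im kap), (complex.Im kap) => e e0.
have C0 : 0 < modulus kap + 2 * modulus w + 1.
  by rewrite ltr_wpDl // addr_ge0 ?mulr_ge0 ?modulus_ge0.
have w0 : 0 < modulus w by rewrite modulus_cexp expR_gt0.
set C := (X in 0 < X) in C0.
have e'0 : 0 < e / C by rewrite divr_gt0.
have m10 : 0 < Num.min 1 (e / C) by rewrite lt_min ltr01.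
have [d1 d10 hF] := derivable_modulus dF e'0.
have [d2 d20 hE] := cexp_near0 m10.
exists (Num.min d2 (d1 / (4 * modulus w))).
  by rewrite lt_min d20 divr_gt0 // mulr_gt0.
move=> h k; rewrite !le_min => /andP[h2 h1] /andP[k2 k1].
have := hE h k h2 k2; set r := cexp h k - 1 - _ => hr.
set s := `|h| + `|k|; have s0 : 0 <= s by rewrite addr_ge0.
have hks : modulus (h +i* k) <= s by exact: ler_modulus.
have r1 : modulus r <= s.
  by apply: le_trans hr _; rewrite ler_piMl // ge_min lexx.
have re : modulus r <= e / C * s.
  by apply: le_trans hr _; rewrite ler_wpM2r // ge_min lexx orbT.
pose t := w * (cexp h k - 1).
have tE : t = w * ((h +i* k) + r) by rewrite /t /r subrKC.
have t2 : modulus t <= 2 * modulus w * s.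
  rewrite tE modulusM [2 * _]mulrC -mulrA ler_wpM2l ?modulus_ge0 //.
  by apply: le_trans (ler_modulusD _ _) _; rewrite mulr_natl mulr2n lerD.
have td : modulus t <= d1.
  apply: le_trans t2 _; rewrite ler_pdivlMr ?mulr_gt0 // in h1.
  rewrite ler_pdivlMr ?mulr_gt0 // in k1.
  by rewrite /s; clear -h1 k1; lra.
have hFt := hF t td.
have FE : F (cexp (x + h) (y + k)) = F (w + t).
  by rewrite cexpD /t mulrBr mulr1 addrC subrK.
have main : modulus (F (w + t) - F w - kap * (h +i* k)) <= e * s.
  have -> : F (w + t) - F w - kap * (h +i* k) =
    (F (w + t) - F w - t * 'D_1 F w) + kap * r by rewrite tE /kap; ring.
  apply: le_trans (ler_modulusD _ _) _.
  have -> : e = e / C * (2 * modulus w) + modulus kap * (e / C) + e / C.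
    by rewrite /C; field; rewrite gt_eqF.
  rewrite mulrDl [X in _ <= X + _]mulrDl -[X in X <= _]addr0; apply: lerD; last first.
    by rewrite mulr_ge0 // ltW.
  apply: lerD.
    by apply: le_trans hFt _; rewrite -mulrA ler_wpM2l // ltW.
  by rewrite modulusM -mulrA ler_wpM2l ?modulus_ge0.
rewrite FE; split; [have := ler_Re (F (w + t) - F w - kap * (h +i* k))
  |have := ler_Im (F (w + t) - F w - kap * (h +i* k))] => /le_trans/(_ main).
  by rewrite !ReB; case: (kap) => a b /=; rewrite mulNr.
by rewrite !ImB; case: (kap) => a b /=; rewrite [b * h + _]addrC.
Qed.

End exponential.

Lemma twopi_gt0 (K : realType) : 0 < pi *+ 2 :> K.
Proof. by rewrite pmulrn_lgt0 // pi_gt0. Qed.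

(** The mean over the circle of radius [exp x] does not depend on [x], because the
    flux out of [[a, b] x [0, 2 pi]] is the difference of the means for [b] and
    [a], the horizontal sides contributing equal amounts by periodicity.  The
    centre itself is never reached, which is why continuity is enough there. *)
Lemma mean_value_circle (K : realType) (F : K[i]^o -> K[i]^o) (rho : K) :
  0 < rho ->
  (forall t, 0 < modulus t <= rho -> derivable F t 1) ->
  {for 0, continuous F} ->
  \int[@lebesgue_measure K]_(y in `[0, pi *+ 2])
    complex.Re (F (rho%:C * cexp 0 y)) = complex.Re (F 0) * (pi *+ 2).
Proof.
move=> rho0 dF cF; have pi0 : 0 <= pi *+ 2 :> K by rewrite mulrn_wge0 // pi_ge0.
pose P x y := complex.Re (F (cexp x y)).
pose Q x y := complex.Im (F (cexp x y)).
pose b := ln rho; have rhoE : expR b = rho by rewrite lnK.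
have PbE y : complex.Re (F (rho%:C * cexp 0 y)) = P b y.
  have -> // : rho%:C * cexp 0 y = cexp b y.
  rewrite /cexp expR0 rhoE !mul1r; apply/eqP; rewrite eq_complex /=.
  by apply/andP; split; apply/eqP; ring.
have df x y : x <= b -> divergence_free_at P Q x y.
  move=> xb; apply: divergence_free_cexp; apply: dF.
  by rewrite modulus_cexp expR_gt0 -rhoE ler_expR.
have cP x : x <= b -> {within `[0, pi *+ 2], continuous (P x)}.
  move=> xb; apply: continuous_in_subspaceT => y _.
  by have [] := divergence_free_continuous (df x y xb).
have close e : 0 < e -> `|\int[@lebesgue_measure K]_(y in `[0, pi *+ 2]) P b y -
    complex.Re (F 0) * (pi *+ 2)| <= e * (pi *+ 2).
  move=> e0; have [d d0 hd] := (continuous_modulusP F 0).1 cF e e0.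
  pose a := Num.min b (ln d).
  have ab : a <= b by rewrite ge_min lexx.
  have ad : expR a <= d.
    by rewrite -[leRHS](lnK d0) ler_expR ge_min lexx orbT.
  have Pa : `|\int[@lebesgue_measure K]_(y in `[0, pi *+ 2]) P a y -
      complex.Re (F 0) * (pi *+ 2)| <= e * (pi *+ 2).
    rewrite -{2 3}[pi *+ 2]subr0; apply: integral_segment_near => //; first exact: cP.
    move=> y _; rewrite /P -ReB; apply: le_trans (ler_Re _) _.
    by apply: hd; rewrite subr0 modulus_cexp.
  have : flux P Q a b 0 (pi *+ 2) = 0.
    by apply: goursat_rectangle => // x y /andP[_ xb] _; exact: df.
  rewrite /flux [X in _ - X](_ : _ = 0); last first.
    rewrite -[RHS](Rintegral_set0 (@lebesgue_measure K) (fun=> 0)).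
    rewrite Rintegral_set0 -[RHS](mul0r (fine (@lebesgue_measure K `[a, b]))).
    rewrite -Rintegral_cst //; apply: eq_Rintegral => x _.
    by rewrite /Q cexp_periodic subrr.
  rewrite subr0 RintegralB //; last 2 first.
  - exact/integrable_segment/cP.
  - exact/integrable_segment/cP.
  by move=> /eqP; rewrite subr_eq0 => /eqP ->.
under eq_Rintegral do rewrite PbE.
apply/eqP; rewrite -subr_eq0 -normr_le0; apply/ler_addgt0Pl => e e0.
rewrite addr0; have pi1 : 0 < pi *+ 2 :> K by rewrite mulrn_wgt0 // pi_gt0.
have := close _ (divr_gt0 e0 pi1).
by rewrite divfK // gt_eqF.
Qed.

(** * The maximum principle *)

(** On the circle, [|a + t| ^ 2] is the real part of the affine, hence holomorphic,
    function [F t := 2 a^* t + |a| ^ 2 + rho ^ 2] of [t]. *)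
Lemma mean_sqr_circle (K : realType) (a : K[i]) (rho : K) : 0 < rho ->
  \int[@lebesgue_measure K]_(y in `[0, pi *+ 2])
    modulus (a + rho%:C * cexp 0 y) ^+ 2 = (modulus a ^+ 2 + rho ^+ 2) * (pi *+ 2).
Proof.
move=> rho0.
pose F (t : K[i]^o) : K[i]^o := 2 * (a^*)%C * t + (modulus a ^+ 2 + rho ^+ 2)%:C.
have dF t : derivable F t 1.
  by apply: derivableD => //; apply: derivableZ.
have := @mean_value_circle K F rho rho0 (fun t _ => dF t).
have -> : complex.Re (F 0) = modulus a ^+ 2 + rho ^+ 2 by rewrite /F mulr0 add0r.
move=> <-; last first.
  by apply: differentiable_continuous; apply/derivable1_diffP.
apply: eq_Rintegral => y _; rewrite !modulus_sqr /F; case: a {F dF} => a b.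
have := cos2Dsin2 y.
rewrite /cexp expR0 !mul1r /=.
move=> cs; have -> : rho ^+ 2 = rho ^+ 2 * (cos y ^+ 2 + sin y ^+ 2).
  by rewrite cs mulr1.
by rewrite modulus_sqr /=; ring.
Qed.

(** The function [u + e q], with [e > 0], has no maximum at a point [z] off [S],
    since its mean over the loop [g] exceeds its value at [z].  So its maximum over
    [D] is attained on [S], and [e] can be chosen so small that the bounded term
    [e q] does not spoil the estimate.  The loops are left abstract in order to
    cover both discs and polydiscs. *)
Lemma maximum_principle (K : realType) (T : topologicalType) (D S : set T)
    (u q : T -> K) (B M : K) :
  compact D ->
  (forall z, D z -> {for z, continuous u}) ->
  (forall z, D z -> {for z, continuous q}) ->
  (forall z, D z -> 0 <= q z <= B) ->
  (forall z, D z -> ~ S z -> exists g : K -> T,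
    [/\ continuous g, forall y, D (g y),
      \int[@lebesgue_measure K]_(y in `[0, pi *+ 2]) u (g y) = u z * (pi *+ 2) &
      q z * (pi *+ 2) <
        \int[@lebesgue_measure K]_(y in `[0, pi *+ 2]) q (g y)]) ->
  (forall z, S z -> u z <= M) -> forall z, D z -> u z <= M.
Proof.
move=> cD cu cq qB mean uM z Dz; rewrite leNgt; apply/negP => Mu.
have B0 : 0 <= B by have /andP[] := qB z Dz; exact: le_trans.
pose e := (u z - M) / (B + 1).
have e0 : 0 < e by rewrite divr_gt0 ?subr_gt0 // ltr_wpDl.
have cv w : D w -> {for w, continuous (fun w => u w + e * q w)}.
  by move=> Dw; apply: cvgD; [exact: cu|apply: cvgMr; exact: cq].
have [c /set_mem Dc maxc] : exists2 c, c \in D &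
    forall t, t \in D -> u t + e * q t <= u c + e * q c.
  apply: (@compact_EVT_max _ _ (fun w => u w + e * q w)) => //.
    by exists z.
  by apply: continuous_in_subspaceT => w /set_mem; exact: cv.
have pi0 : 0 <= pi *+ 2 :> K by rewrite mulrn_wge0 // pi_ge0.
have pi2 : 0 < pi *+ 2 :> K by rewrite mulrn_wgt0 // pi_gt0.
have [Sc|nSc] := pselect (S c).
  have := maxc z (mem_set Dz); rewrite leNgt => /negP; apply.
  have /andP[qz _] := qB z Dz; have /andP[_ qc] := qB c Dc.
  apply: (@lt_le_trans _ _ (u z)); last by rewrite lerDl mulr_ge0 // ltW.
  apply: (@le_lt_trans _ _ (M + e * B)).
    by rewrite lerD ?uM // ler_wpM2l // ltW.
  rewrite -ltrBrDl /e mulrAC ltr_pdivrMr ?ltr_wpDl //.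
  by rewrite ltr_pM2l ?subr_gt0 // ltrDl.
have [g [cg Dg ug qg]] := mean c Dc nSc.
have cug : {within `[0, pi *+ 2], continuous (u \o g)}.
  apply: continuous_in_subspaceT => y _.
  by apply: continuous_comp; [exact: cg|exact: cu].
have cqg : {within `[0, pi *+ 2], continuous (q \o g)}.
  apply: continuous_in_subspaceT => y _.
  by apply: continuous_comp; [exact: cg|exact: cq].
have cqe : {within `[0, pi *+ 2], continuous (fun y => e * q (g y))}.
  apply: continuous_in_subspaceT => y _.
  by apply: cvgMr; apply: continuous_comp; [exact: cg|exact: cq].
have cvg : {within `[0, pi *+ 2], continuous (fun y => u (g y) + e * q (g y))}.
  apply: continuous_in_subspaceT => y _.
  by apply: (continuous_comp (cg y) (cv _ (Dg y))).
have := @integral_segment_le K 0 (pi *+ 2) (u c + e * q c) _ pi0 cvg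
  (fun y _ => maxc _ (mem_set (Dg y))).
rewrite RintegralD //; last 2 first.
- exact: (integrable_segment cug).
- exact: (integrable_segment cqe).
rewrite RintegralZl //; last exact: (integrable_segment cqg).
rewrite ug subr0 mulrDl lerD2l -mulrA ler_pM2l // leNgt => /negP; apply.
exact: qg.
Qed.

Lemma continuous_Re (K : realType) : continuous (fun z : K[i]^o => complex.Re z).
Proof.
move=> a; apply/(cvgrPdist_le (F := nbhs a)) => e e0.
apply/(near_modulusP a); exists e => // t te.
by rewrite -ReB; apply: le_trans (ler_Re _) _; rewrite modulusB.
Qed.

Lemma continuous_modulus (K : realType) : continuous (fun z : K[i]^o => modulus z).
Proof.
move=> a; apply/(cvgrPdist_le (F := nbhs a)) => e e0.
apply/(near_modulusP a); exists e => // t te; apply: le_trans te.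
rewrite ler_norml; apply/andP; split.
  rewrite lerBrDl lerBlDr.
  by have := ler_modulusD (t - a) a; rewrite subrK addrC.
rewrite lerBlDr modulusB.
by have := ler_modulusD (a - t) t; rewrite subrK.
Qed.

Lemma continuous_complex (K : realType) (T : topologicalType) (f g : T -> K)
    (x : T) : {for x, continuous f} -> {for x, continuous g} ->
  {for x, continuous (fun x => (f x +i* g x : K[i]^o))}.
Proof.
move=> /cvgrPdist_le cf /cvgrPdist_le cg.
apply/(cvgrPdist_le (F := nbhs x)) => e /gt0_complexP[r r0 ->].
have r2 : 0 < r / 2 by rewrite divr_gt0.
near=> t; rewrite modulusE lecR; apply: le_trans (ler_modulus _) _ => /=.
rewrite (splitr r) lerD //; near: t; [exact: cf|exact: cg].
Unshelve. all: by end_near. Qed.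

Lemma continuous_circle (K : realType) (rho : K) :
  continuous ((fun y => rho%:C * cexp 0 y) : K -> K[i]^o).
Proof.
have -> : (fun y => rho%:C * cexp 0 y) =
    (fun y => (rho * cos y) +i* (rho * sin y)) :> (K -> K[i]^o).
  apply/funext => y; rewrite /cexp expR0 !mul1r.
  by apply/eqP; rewrite eq_complex /= !mul0r subr0 addr0 !eqxx.
move=> y; apply: (@continuous_complex K K (fun y => rho * cos y)
  (fun y => rho * sin y)); apply: cvgMr;
  [exact: continuous_cos|exact: continuous_sin].
Qed.

Lemma compact_disc (K : realType) (R : K) :
  compact [set z : K[i]^o | modulus z <= R].
Proof.
pose f (p : K * K) : K[i]^o := p.1 +i* p.2.
apply: (@subclosed_compact _ _ (f @` (`[- R, R] `*` `[- R, R]))).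
- apply: (@preimage_closed _ _ (fun z : K[i]^o => modulus z) [set x | x <= R]).
    by move=> z _; exact: continuous_modulus.
  exact: closed_le.
- apply: continuous_compact; last by apply: compact_setX; exact: segment_compact.
  apply: continuous_subspaceT => p.
  exact: (@continuous_complex K (K * K)%type fst snd p cvg_fst cvg_snd).
- move=> [x y] /= zR; exists (x, y) => //=.
  split; rewrite /= in_itv /= -ler_norml; apply: le_trans zR.
    exact: (ler_Re (x +i* y)).
  exact: (ler_Im (x +i* y)).
Qed.

Lemma derivable_continuous_at (K : realType) (F : K[i]^o -> K[i]^o) (t : K[i]^o) :
  derivable F t 1 -> {for t, continuous F}.
Proof. by move=> /derivable1_diffP/differentiable_continuous. Qed.

Lemma derivable_line (R : numFieldType) (V W : normedModType R) (f : V -> W)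
    (z e : V) (t : R) :
  derivable f (z + t *: e) e -> derivable (fun t : R^o => f (z + t *: e)) t 1.
Proof.
rewrite /derivable /comp /shift /=.
suff -> : (fun h : R => h^-1 *: (f (z + (h *: 1 + t) *: e) - f (z + t *: e))) =
  (fun h => h^-1 *: (f (h *: e + (z + t *: e)) - f (z + t *: e))) by [].
by apply/funext => h; rewrite [_ *: 1]mulr1 scalerDl addrCA.
Qed.

Lemma derivable_translate (R : numFieldType) (W : normedModType R)
    (f : R^o -> W) (s t : R^o) :
  derivable f (s + t) 1 -> derivable (fun t => f (s + t)) t 1.
Proof.
move=> df; have -> : (fun t => f (s + t)) = (fun t : R^o => f (s + t *: 1)).
  by apply/funext => u; rewrite scaler1.
by apply: derivable_line; rewrite scaler1.
Qed.

(** * Schwarz's lemma and the Borel-Caratheodory theorem *)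

(** The function [phi] is [G t / t], and its value at [0] is [G' 0]; it is
    continuous at [0] and holomorphic elsewhere, so that the maximum principle
    applies to the real part of [w phi] for every constant [w].  The choice of [w]
    as the conjugate of [phi t] turns this into a bound of [|phi t|]. *)
Lemma schwarz (K : realType) (R : K) (G : K[i]^o -> K[i]^o) :
  0 < R -> (forall t, modulus t <= R -> derivable G t 1) -> G 0 = 0 ->
  (forall t, modulus t <= R -> modulus (G t) <= 1) ->
  forall t, modulus t <= R -> modulus (G t) * R <= modulus t.
Proof.
move=> R0 dG G0 G1.
have R00 : modulus (0 : K[i]) <= R by rewrite modulus0 ltW.
pose c := 'D_1 G 0.
(* As [0^-1 = 0], this formula gives [phi 0 = c] without a case distinction. *)
pose phi (t : K[i]^o) : K[i]^o := (G t - c * t) * t^-1 + c.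
have phiE t : t != 0 -> phi t = G t / t.
  by move=> t0; rewrite /phi mulrBl mulfK // subrK.
have dphi t : 0 < modulus t <= R -> derivable phi t 1.
  rewrite modulus_gt0 => /andP[t0 tR]; apply: derivableD => //.
  apply: derivableM; last exact: derivableV.
  by apply: derivableB; [exact: dG|apply: derivableZ].
have cphi t : modulus t <= R -> {for t, continuous phi}.
  move=> tR; have [->|t0] := eqVneq t 0; last first.
    by apply: derivable_continuous_at; apply: dphi; rewrite modulus_gt0 t0.
  apply/continuous_modulusP => e e0.
  have [d d0 hd] := derivable_modulus (dG 0 R00) e0; exists d => // s.
  rewrite subr0 => /hd; rewrite add0r G0 subr0 -/c => hs.
  rewrite /phi mulr0 G0 subrr mul0r add0r addrK modulusM modulusV.
  have [->|s0] := eqVneq s 0; first by rewrite G0 mulr0 subrr modulus0 mul0r ltW.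
  by rewrite ler_pdivrMr ?modulus_gt0 // mulrC.
have bound w : forall t, modulus t <= R -> complex.Re (w * phi t) <= modulus w / R.
  apply: (@maximum_principle K K[i]^o [set t | modulus t <= R]
    [set t | modulus t = R] (fun t => complex.Re (w * phi t))
    (fun t => modulus t ^+ 2) (R ^+ 2)).
  - exact: compact_disc.
  - move=> s /cphi cs.
    apply: (@continuous_comp _ _ _ (fun t : K[i]^o => w * phi t : K[i]^o)).
      exact: (@cvgMl_tmp _ _ (nbhs s) _ phi w _ cs).
    exact: continuous_Re.
  - move=> s _; apply: (@continuous_comp _ _ _ (fun t : K[i]^o => modulus t)
      (fun x => x ^+ 2)).
      exact: continuous_modulus.
    exact: exprn_continuous.
  - move=> s /= sR; rewrite sqr_ge0 /= ler_pXn2r ?nnegrE ?modulus_ge0 //.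
    exact: ltW.
  - move=> s /= sR /eqP nR; have {nR}sR : modulus s < R by rewrite lt_neqAle nR.
    (* Off the centre, the circle has to avoid the origin, where [phi] is only
       known to be continuous. *)
    have [rho [rho0 srho ne0]] : exists rho : K, [/\ 0 < rho, modulus s + rho <= R &
        forall t, 0 < modulus t <= rho -> s + t != 0].
      have [->|s0] := eqVneq s 0.
        exists R; rewrite modulus0 add0r; split=> // t.
        by rewrite modulus_gt0 add0r => /andP[].
      have ms0 : 0 < modulus s by rewrite modulus_gt0.
      exists (Num.min (R - modulus s) (modulus s / 2)); split.
      - by rewrite lt_min subr_gt0 sR divr_gt0.
      - by rewrite -lerBrDl ge_min lexx.
      - move=> t /andP[_ ts]; rewrite addr_eq0; apply/eqP => st.
        move: ts; rewrite -modulusN -st le_min => /andP[_].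
        by rewrite ler_pdivlMr // mulr_natr mulr2n gerDl leNgt ms0.
    have sD t : modulus t <= rho -> modulus (s + t) <= R.
      move=> tr; apply: le_trans (ler_modulusD _ _) _.
      by apply: le_trans srho; rewrite lerD2l.
    exists (fun y => s + rho%:C * cexp 0 y); split.
    - move=> y; apply: (@cvgD _ _ _ (nbhs y) _ (fun=> s : K[i]^o)).
        exact: cvg_cst.
      exact: continuous_circle.
    - by move=> y; apply: sD; rewrite modulusM modulus_cexp expR0 mulr1
        modulus_real ger0_norm // ltW.
    - rewrite -[in RHS](addr0 s).
      apply: (@mean_value_circle K (fun t => w * phi (s + t))) => // [t tr|].
        apply: derivableM; first exact: derivable_cst.
        apply: derivable_translate; apply: dphi.
        by rewrite modulus_gt0 ne0 //= sD //; case/andP: tr.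
      apply: (@cvgMl_tmp _ _ (nbhs 0) _ (fun t => phi (s + t)) w).
      apply: (@continuous_comp _ _ _ (fun t : K[i]^o => s + t : K[i]^o) phi).
        apply: (@cvgD _ _ _ (nbhs 0) _ (fun=> s : K[i]^o)); first exact: cvg_cst.
        exact: cvg_id.
      by rewrite addr0; apply: cphi; exact: ltW.
    - rewrite mean_sqr_circle // ltr_pM2r ?twopi_gt0 //.
      by rewrite ltrDl exprn_gt0.
  - move=> s /= sR; apply: le_trans (ler_norm _) _; apply: le_trans (ler_Re _) _.
    have s0 : s != 0 by rewrite -modulus_gt0 sR.
    rewrite modulusM phiE // modulusM modulusV sR mulrA ler_pM2r ?invr_gt0 //.
    by rewrite ler_piMr ?modulus_ge0 // G1 // sR.
move=> t tR; have [->|t0] := eqVneq t 0; first by rewrite G0 modulus0 mul0r.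
have := bound (phi t)^*%C t tR.
have -> : complex.Re ((phi t)^*%C * phi t) = modulus (phi t) ^+ 2.
  by rewrite modulus_sqr; case: (phi t) => a b /=; ring.
have modJ (w : K[i]) : modulus w^*%C = modulus w.
  by case: w => a b; rewrite /modulus /= sqrrN.
rewrite modJ expr2 phiE // modulusM modulusV.
have mt0 : 0 < modulus t by rewrite modulus_gt0.
have [->|Gt0] := eqVneq (modulus (G t)) 0; first by rewrite !mul0r modulus_ge0.
have mG0 : 0 < modulus (G t) by rewrite lt_neqAle eq_sym Gt0; exact: modulus_ge0.
rewrite ler_pM2l ?divr_gt0 //.
by rewrite ler_pdivrMr // mulrC ler_pdivlMr.
Qed.

(** The condition [Re G <= A] says that [G] is at least as close to [0] as to
    [2 A], so that [G / (2 A - G)] has modulus at most [1].  Schwarz's lemma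
    bounds this quotient by [|t| / R], and solving for [G] gives the claim. *)
Lemma borel_caratheodory_vanishing (K : realType) (R A : K)
    (G : K[i]^o -> K[i]^o) :
  0 < R -> 0 < A -> (forall t, modulus t <= R -> derivable G t 1) -> G 0 = 0 ->
  (forall t, modulus t <= R -> complex.Re (G t) <= A) ->
  forall t, modulus t <= R -> modulus (G t) * (R - modulus t) <= 2 * A * modulus t.
Proof.
move=> R0 A0 dG G0 GA t tR.
pose H (s : K[i]^o) : K[i]^o := (2 * A)%:C - G s.
have H0 s : modulus s <= R -> H s != 0.
  move=> /GA sA; apply/eqP => /(congr1 (@complex.Re K)); rewrite /H ReB /=.
  apply/eqP; rewrite gt_eqF // subr_gt0; apply: le_lt_trans sA _.
  by rewrite ltr_pMl ?ltr1n.
have GH s : modulus s <= R -> modulus (G s) <= modulus (H s).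
  move=> /GA sA; rewrite -(@ler_pXn2r _ 2) ?nnegrE ?modulus_ge0 // !modulus_sqr.
  rewrite /H ReB ImB /= sub0r sqrrN lerD2r.
  have : 0 <= A * (A - complex.Re (G s)) by rewrite mulr_ge0 ?subr_ge0 // ltW.
  by move: (complex.Re _) => x; clear => ?; nra.
have := @schwarz K R (fun s => G s * (H s)^-1) R0 _ _ _ t tR.
have Ht : 0 < modulus (H t) by rewrite modulus_gt0 H0.
rewrite modulusM modulusV mulrAC ler_pdivrMr // => schw.
have {schw}: modulus (G t) * R <= modulus t * modulus (H t).
  apply: schw; first move=> s sR.
  - apply: derivableM; first exact: dG.
    apply: derivableV; first exact: H0.
    by apply: derivableB; [exact: derivable_cst|exact: dG].
  - by rewrite G0 mul0r.
  - move=> s sR; rewrite modulusM modulusV ler_pdivrMr ?modulus_gt0 ?H0 //.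
    by rewrite mul1r; exact: GH.
have : modulus (H t) <= 2 * A + modulus (G t).
  apply: le_trans (ler_modulusD _ _) _; rewrite modulusN modulus_real.
  by rewrite ger0_norm // mulr_ge0 // ltW.
move=> /(ler_wpM2l (modulus_ge0 t)) h1 /le_trans/(_ h1).
by move: (modulus t) (modulus (G t)) => x y; clear => ?; lra.
Qed.

(** This is [borel_caratheodory_vanishing] for [g - g 0], whose real part is at
    most [A + |g 0|].  That bound may be [0], hence the small positive number
    added to it. *)
Lemma borel_caratheodory (K : realType) (R A : K) (g : K[i]^o -> K[i]^o) :
  0 < R -> (forall t, modulus t <= R -> derivable g t 1) ->
  (forall t, modulus t <= R -> complex.Re (g t) <= A) ->
  forall t, modulus t < R ->
    modulus (g t) <= 2 * modulus t / (R - modulus t) * A +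
      (R + modulus t) / (R - modulus t) * modulus (g 0).
Proof.
move=> R0 dg gA t tR; have tR' := ltW tR.
have d0 : 0 < R - modulus t by rewrite subr_gt0.
suff : modulus (g t - g 0) * (R - modulus t) <=
    2 * (A + modulus (g 0)) * modulus t.
  move=> h; have := ler_modulusD (g t - g 0) (g 0); rewrite subrK.
  move=> /(ler_wpM2r (ltW d0)); rewrite mulrDl => /le_trans/(_ (lerD h (lexx _))).
  have -> : 2 * modulus t / (R - modulus t) * A +
      (R + modulus t) / (R - modulus t) * modulus (g 0) =
    (2 * (A + modulus (g 0)) * modulus t + modulus (g 0) * (R - modulus t)) /
      (R - modulus t) by field; rewrite gt_eqF.
  by rewrite ler_pdivlMr.
have R00 : modulus (0 : K[i]) <= R by rewrite modulus0 ltW.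
apply/ler_addgt0Pr => e e0.
have e'0 : 0 < e / (2 * R) by rewrite divr_gt0 // mulr_gt0.
have A0 : 0 < A + modulus (g 0) + e / (2 * R).
  rewrite ltr_wpDl // -lerBlDr sub0r.
  have := ler_Re (g 0); rewrite ler_norml => /andP[/le_trans h _]; apply: h.
  exact: gA.
apply: le_trans (borel_caratheodory_vanishing R0 A0 (G := fun s => g s - g 0)
  _ _ _ tR') _.
- by move=> s sR; apply: derivableB; [exact: dg|exact: derivable_cst].
- by rewrite subrr.
- move=> s sR; rewrite ReB; apply: le_trans (lerB (gA s sR) (lexx _)) _.
  rewrite -addrA lerD2l ler_wpDr ?(ltW e'0) //.
  by have := ler_Re (g 0); rewrite ler_norml lerNl => /andP[].
rewrite mulrDr mulrDl lerD2l.
have -> : 2 * (e / (2 * R)) * modulus t = e * (modulus t / R).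
  by field; rewrite gt_eqF.
by rewrite ler_piMr ?(ltW e0) // ler_pdivrMr // mul1r.
Qed.

(** * Polydiscs, Shilov boundaries and Euclidean spheres *)

Section polydisc.
Context (K : realType) (m : nat).
Implicit Types (z : Cn K m) (R r : K) (f : Cn K m -> K[i]^o).

Lemma continuous_coord_modulus (i : 'I_m) :
  continuous (fun z : Cn K m => modulus (z ord0 i)).
Proof.
move=> z; apply: (@continuous_comp _ _ _ (fun z : Cn K m => z ord0 i)
  (fun t : K[i]^o => modulus t)).
  exact: coord_continuous.
exact: continuous_modulus.
Qed.

Lemma continuous_sum_sqr :
  continuous (fun z : Cn K m => \sum_(i < m) modulus (z ord0 i) ^+ 2).
Proof.
move=> z; apply: (@cvg_big K 'I_m +%R 0 xpredT (@add_continuous K) _ (nbhs z)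
  _ (fun i (z : Cn K m) => modulus (z ord0 i) ^+ 2)) => i _.
apply: (@continuous_comp _ _ _ (fun z : Cn K m => modulus (z ord0 i))
  (fun x => x ^+ 2)).
  exact: continuous_coord_modulus.
exact: exprn_continuous.
Qed.

Lemma compact_closed_polydisc R : compact (closed_polydisc m R : set (Cn K m)).
Proof.
exact: (@rV_compact K[i]^o m (fun=> [set t | modulus t <= R])
  (fun=> @compact_disc K R)).
Qed.

Lemma compact_shilov_boundary R : compact (shilov_boundary m R : set (Cn K m)).
Proof.
apply: (@rV_compact K[i]^o m (fun=> [set t | modulus t = R])) => _.
apply: (@subclosed_compact _ _ [set t : K[i]^o | modulus t <= R]).
- apply: (@preimage_closed _ _ (fun t : K[i]^o => modulus t) [set R]).
    by move=> z _; exact: continuous_modulus.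
  exact: closed_eq.
- exact: compact_disc.
- by move=> t /= ->.
Qed.

Lemma euclid_sphere_polydisc r : 0 <= r ->
  (euclid_sphere m r : set (Cn K m)) `<=` closed_polydisc m r.
Proof.
move=> r0 z /= zr i; rewrite -(@ler_pXn2r _ 2) ?nnegrE ?modulus_ge0 //.
rewrite -zr sqr_sqrtr ?sumr_ge0 // => [|j _]; last exact: sqr_ge0.
by rewrite (bigD1 i) //= lerDl sumr_ge0 // => j _; exact: sqr_ge0.
Qed.

Lemma compact_euclid_sphere r : 0 <= r ->
  compact (euclid_sphere m r : set (Cn K m)).
Proof.
move=> r0; apply: (@subclosed_compact _ _ (closed_polydisc m r)).
- apply: (@preimage_closed _ _ (@euclid_norm K m) [set r]); last exact: closed_eq.
  move=> z _; apply: (@continuous_comp _ _ _ _ (@Num.sqrt K)).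
    exact: continuous_sum_sqr.
  exact: sqrt_continuous.
- exact: compact_closed_polydisc.
- exact: euclid_sphere_polydisc.
Qed.

Lemma closed_polydisc_le r R : r <= R ->
  (closed_polydisc m r : set (Cn K m)) `<=` closed_polydisc m R.
Proof. by move=> rR z zr i; exact: le_trans rR. Qed.

(** Off the Shilov boundary some [|z_i| < R], and the circle of radius
    [R - |z_i|] around [z] in the direction of the [i]-th coordinate stays in the
    polydisc. *)
Lemma Re_le_shilov R M f : 0 < R ->
  (forall z, closed_polydisc m R z -> differentiable f z) ->
  (forall z, shilov_boundary m R z -> complex.Re (f z) <= M) ->
  forall z, closed_polydisc m R z -> complex.Re (f z) <= M.
Proof.
move=> R0 df fM.
apply: (@maximum_principle K (Cn K m) (closed_polydisc m R) (shilov_boundary m R)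
  (fun z => complex.Re (f z)) (fun z => \sum_(i < m) modulus (z ord0 i) ^+ 2)
  (\sum_(i < m) R ^+ 2)) => //.
- exact: compact_closed_polydisc.
- move=> z /df/differentiable_continuous fz.
  apply: (@continuous_comp _ _ _ f (fun t : K[i]^o => complex.Re t)) => //.
  exact: continuous_Re.
- by move=> z _; exact: continuous_sum_sqr.
- move=> z zR; rewrite sumr_ge0 /= => [|i _]; last exact: sqr_ge0.
  by apply: ler_sum => i _; rewrite ler_pXn2r ?nnegrE ?modulus_ge0 ?(ltW R0) //.
move=> z zR /existsNP[i /eqP ziR].
have {ziR}ziR : modulus (z ord0 i) < R by rewrite lt_neqAle ziR zR.
pose rho := R - modulus (z ord0 i); have rho0 : 0 < rho by rewrite subr_gt0.
pose e : Cn K m := delta_mx ord0 i.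
have eE t j : (z + t *: e) ord0 j = if j == i then z ord0 i + t else z ord0 j.
  rewrite !mxE eqxx /=; case: eqVneq => [->|_]; first by rewrite mulr1.
  by rewrite mulr0 addr0.
have eD t : modulus t <= rho -> closed_polydisc m R (z + t *: e).
  move=> tr j; rewrite eE; case: ifP => // _.
  by apply: le_trans (ler_modulusD _ _) _; rewrite -lerBrDl.
have circ y : modulus (rho%:C * cexp 0 y) = rho.
  by rewrite modulusM modulus_cexp expR0 mulr1 modulus_real ger0_norm // ltW.
exists (fun y => z + (rho%:C * cexp 0 y) *: e); split.
- move=> y; apply: (@cvgD _ _ _ (nbhs y) _ (fun=> z)); first exact: cvg_cst.
  apply: (@cvgZr_tmp _ _ _ (nbhs y) _ _ _ e); exact: continuous_circle.
- by move=> y; apply: eD; rewrite circ.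
- have -> : f z = f (z + 0 *: e) by rewrite scale0r addr0.
  apply: (@mean_value_circle K (fun t => f (z + t *: e))) => // [t /andP[_ tr]|].
    by apply: derivable_line; apply: diff_derivable; apply/df/eD.
  apply: derivable_continuous_at; apply: derivable_line.
  by apply: diff_derivable; apply/df/eD; rewrite modulus0 ltW.
- have sumE y : \sum_(j < m) modulus ((z + (rho%:C * cexp 0 y) *: e) ord0 j) ^+ 2 =
      modulus (z ord0 i + rho%:C * cexp 0 y) ^+ 2 +
      \sum_(j < m | j != i) modulus (z ord0 j) ^+ 2.
    rewrite (bigD1 i) //= eE eqxx; congr (_ + _).
    by apply: eq_bigr => j /negPf ji; rewrite eE ji.
  under eq_Rintegral do rewrite sumE.
  rewrite (bigD1 i) //= RintegralD //; last 2 first.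
  + apply: (integrable_segment
      (f := fun y => modulus (z ord0 i + rho%:C * cexp 0 y) ^+ 2)).
    apply: continuous_subspaceT => y.
    apply: (@continuous_comp _ _ _ (fun y => z ord0 i + rho%:C * cexp 0 y : K[i]^o)
      (fun t : K[i]^o => modulus t ^+ 2)).
      apply: (@cvgD _ _ _ (nbhs y) _ (fun=> z ord0 i)); first exact: cvg_cst.
      exact: continuous_circle.
    apply: (@continuous_comp _ _ _ (fun t : K[i]^o => modulus t) (fun x => x ^+ 2)).
      exact: continuous_modulus.
    exact: exprn_continuous.
  + set c := \sum_(j < m | _) _.
    by apply: (integrable_segment (f := cst c)) => y; exact: cvg_cst.
  rewrite mean_sqr_circle // Rintegral_cst //= lebesgue_measure_itv /= lte_fin.
  rewrite twopi_gt0 /= subr0 -mulrDl ltr_pM2r ?twopi_gt0 // ltrD2r.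
  by rewrite ltrDl exprn_gt0.
Qed.

End polydisc.

(** Compactness is what gives [maximum] its meaning: otherwise it could be a
    default value. *)
Lemma maximum_compact (K : realType) (T : topologicalType) (D : set T)
    (u : T -> K) : D !=set0 -> compact D ->
  (forall z, D z -> {for z, continuous u}) ->
  exists2 z, D z & maximum (u @` D) = u z /\ forall w, D w -> u w <= u z.
Proof.
move=> D0 cD cu.
have [|z /set_mem Dz maxz] := compact_EVT_max D0 cD (f := u).
  by apply: continuous_in_subspaceT => w /set_mem; exact: cu.
have le w : D w -> u w <= u z by move=> Dw; apply/maxz/mem_set.
exists z => //; split=> //; apply: maximumE; first by exists z.
by move=> _ [w Dw <-]; exact: le.
Qed.

(** * The inequality *)

Theorem lemma2p5 (K : realType) (m : nat) (hm : (1 <= m)%N) (R : K)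
    (hR : 0 < R) (f : Cn K m -> K[i]^o)
    (hf : holomorphic_near (closed_polydisc m R) f)
    (r : K) (hr0 : 0 <= r) (hrR : Num.sqrt m%:R * r < R) :
  max_modulus r f <=
    2 * r / (R - r) * max_Re R f + (R + r) / (R - r) * modulus (f 0).
Proof.
have rR : r < R.
  apply: le_lt_trans hrR; rewrite ler_peMl // -[leLHS]sqrtr1 ler_wsqrtr //.
  by rewrite ler1n.
have df z : closed_polydisc m R z -> differentiable f z.
  by have [U [DU [_ dU]]] := hf; move=> /DU/dU.
have cf z : closed_polydisc m R z -> {for z, continuous f}.
  by move=> /df/differentiable_continuous.
have [w Sw [-> maxw]] : exists2 z, shilov_boundary m R z & max_Re R f =
    complex.Re (f z) /\
    forall w, shilov_boundary m R w -> complex.Re (f w) <= complex.Re (f z).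
  apply: (@maximum_compact K (Cn K m) (shilov_boundary m R)
    (fun z => complex.Re (f z))).
  - by exists (const_mx R%:C) => i; rewrite mxE modulus_real ger0_norm // ltW.
  - exact: compact_shilov_boundary.
  - move=> z zR.
    apply: (@continuous_comp _ _ _ f (fun t : K[i]^o => complex.Re t)).
      by apply: cf => i; rewrite zR.
    exact: continuous_Re.
have sphere_polydisc z : euclid_sphere m r z -> closed_polydisc m R z.
  by move=> /(euclid_sphere_polydisc hr0)/(closed_polydisc_le (ltW rR)).
have [z Sz [-> _]] : exists2 z, euclid_sphere m r z & max_modulus r f =
    modulus (f z) /\
    forall w, euclid_sphere m r w -> modulus (f w) <= modulus (f z).
  apply: (@maximum_compact K (Cn K m) (euclid_sphere m r)
    (fun z => modulus (f z))).
  - exists (r%:C *: delta_mx ord0 (Ordinal hm)).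
    rewrite /euclid_sphere /= /euclid_norm.
    rewrite (bigD1 (Ordinal hm)) //= big1 => [|j /negPf j0].
      by rewrite !mxE !eqxx mulr1 addr0 modulus_real ger0_norm // sqrtr_sqr ger0_norm.
    by rewrite !mxE eqxx j0 mulr0 modulus0 expr0n.
  - exact: compact_euclid_sphere.
  - move=> z /sphere_polydisc zR.
    apply: (@continuous_comp _ _ _ f (fun t : K[i]^o => modulus t)).
      exact: cf.
    exact: continuous_modulus.
(* The sphere of radius [0] is the origin, which spans no complex line. *)
have [r0|r0] := eqVneq r 0.
  have -> : z = 0.
    apply/rowP => i; rewrite mxE; apply/eqP; rewrite -modulus_eq0.
    by rewrite eq_le modulus_ge0 andbT -r0; exact: (euclid_sphere_polydisc hr0 Sz).
  by rewrite r0 mulr0 !mul0r add0r addr0 subr0 divff ?gt_eqF // mul1r.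
have rpos : 0 < r by rewrite lt0r r0.
pose e : Cn K m := r^-1%:C *: z.
have inD t : modulus t <= R -> closed_polydisc m R (0 + t *: e).
  move=> tR i; rewrite add0r !mxE !modulusM modulus_real normfV gtr0_norm //.
  apply: le_trans tR; rewrite ler_piMr ?modulus_ge0 // mulrC ler_pdivrMr // mul1r.
  exact: (euclid_sphere_polydisc hr0 Sz).
have := @borel_caratheodory K R (complex.Re (f w)) (fun t => f (0 + t *: e)) hR
  _ _ r%:C.
rewrite modulus_real (ger0_norm hr0) scale0r addr0 => bc.
have ze : z = 0 + r%:C *: e.
  by rewrite add0r scalerA -rmorphM /= divff // scale1r.
rewrite {1}ze; apply: bc => // [t /inD tD|t /inD tD].
  exact/derivable_line/diff_derivable/df.
exact: (Re_le_shilov hR df maxw).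
Qed.
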